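(* (i) Every strict extension $\Sigma$ of a Clifford semigroup $S$ by a semigroup $T$ (with zero) is a semilattice of ideal extensions of groups. (ii) Conversely, if $\Sigma$ is a semilattice $Y$ of semigroups $\Sigma_\alpha$ ($\alpha\in Y$), where each $\Sigma_\alpha$ is an ideal extension of a group $G_\alpha$, and $S=\bigcup_{\alpha\in Y}G_\alpha$ is an ideal of $\Sigma$, then $S$ is a Clifford semigroup and $\Sigma$ is a strict extension of $S$.
   Context: A semigroup $\Sigma$ is an ideal extension (or just extension) of a semigroup $S$ by a semigroup $T$ with zero if $\Sigma$ contains $S$ as an ideal and the Rees quotient $\Sigma/S$ is isomorphic to $T$; $\Sigma$ is an ideal extension of $S$ if this holds for some $T$. The extension is strict if every element $A\in\Sigma\setminus S$ has the same action on $S$ as some element of $S$, i.e. there is $a\in S$ with $As=as$ and $sA=sa$ for all $s\in S$. A Clifford semigroup is a completely regular inverse semigroup (equivalently, a semilattice of groups). $\Sigma$ is a semilattice $Y$ of semigroups $\Sigma_\alpha$ ($\alpha\in Y$) if $Y$ is a semilattice (commutative semigroup of idempotents), $\Sigma$ is the disjoint union of its subsemigroups $\Sigma_\alpha$, and $\Sigma_\alpha\Sigma_\beta\subseteq\Sigma_{\alpha\beta}$ for all $\alpha,\beta\in Y$. *)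

(* Defs.v *)
From mathcomp Require Import all_boot.
From mathcomp Require Import boolp classical_sets.

Set Implicit Arguments.
Unset Strict Implicit.
Unset Printing Implicit Defensive.

Local Open Scope classical_set_scope.
Local Open Scope group_scope.

(* Semigroups are nonempty by convention. A semigroup lying inside an ambient
   semigroup M is a set A : set M with subsemigroup A; the properties below are
   those of A as a semigroup, all quantifiers being relativized to A. *)

Definition subsemigroup (M : semigroupType) (A : set M) : Prop :=
  A !=set0 /\ forall x y, A x -> A y -> A (x * y).

Definition is_group (M : semigroupType) (G : set M) : Prop :=
  subsemigroup G /\
  exists e, [/\ G e,
    forall x, G x -> e * x = x /\ x * e = x &
    forall x, G x -> exists y, [/\ G y, x * y = e & y * x = e]].

Definition completely_regular (M : semigroupType) (A : set M) : Prop :=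
  forall a, A a -> exists x, [/\ A x, a * x * a = a & a * x = x * a].

Definition inverse_semigroup (M : semigroupType) (A : set M) : Prop :=
  forall a, A a -> exists! x, [/\ A x, a * x * a = a & x * a * x = x].

Definition clifford (M : semigroupType) (A : set M) : Prop :=
  [/\ subsemigroup A, completely_regular A & inverse_semigroup A].

Definition ideal_of (M : semigroupType) (A I : set M) : Prop :=
  [/\ I !=set0, I `<=` A &
      forall s x, I s -> A x -> I (s * x) /\ I (x * s)].

Definition has_zero (T : semigroupType) : Prop :=
  exists z : T, forall x : T, z * x = z /\ x * z = z.

(* The Rees quotient A/I is (A \ I) together with a zero, here None, to which
   every product falling in I is sent. *)
Definition rees (M : semigroupType) (A I : set M) : Type :=
  option (set_type (A `\` I)).

Definition rees_mul (M : semigroupType) (A I : set M) (u v : rees A I) :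
    rees A I :=
  match u, v with
  | Some x, Some y => insub (val x * val y)
  | _, _ => None
  end.

Definition rees_isomorphic (M : semigroupType) (A I : set M)
    (T : semigroupType) : Prop :=
  exists f : rees A I -> T,
    bijective f /\ {morph f : u v / rees_mul u v >-> u * v}.

Definition extension_by (M : semigroupType) (A S : set M)
    (T : semigroupType) : Prop :=
  [/\ subsemigroup A, ideal_of A S, has_zero T & rees_isomorphic A S T].

Definition ideal_extension (M : semigroupType) (A S : set M) : Prop :=
  exists T : semigroupType, extension_by A S T.

Definition strict_extension_by (M : semigroupType) (A S : set M)
    (T : semigroupType) : Prop :=
  extension_by A S T /\
  forall x, (A `\` S) x ->
    exists2 a, S a & forall s, S s -> x * s = a * s /\ s * x = s * a.

Definition strict_extension (M : semigroupType) (A S : set M) : Prop :=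
  exists T : semigroupType, strict_extension_by A S T.

Definition semilattice (Y : semigroupType) : Prop :=
  commutative (fun a b : Y => a * b) /\ idempotent_op (fun a b : Y => a * b).

Definition semilattice_of_semigroups (M Y : semigroupType)
    (F : Y -> set M) : Prop :=
  [/\ semilattice Y,
      forall a, subsemigroup (F a),
      \bigcup_a F a = setT,
      trivIset setT F &
      forall a b x y, F a x -> F b y -> F (a * b) (x * y)].

(* Main.v *)
Require Import Defs.
From HB Require Import structures.
From mathcomp Require Import all_boot.
From mathcomp Require Import boolp classical_sets.

Set Implicit Arguments.
Unset Strict Implicit.
Unset Printing Implicit Defensive.

Local Open Scope classical_set_scope.
Local Open Scope group_scope.

(** Two facts about a Clifford semigroup [S] carry the first half: its
    idempotents are central ([idem_central]), so that each element belongs to a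
    subgroup of [S] whose identity [e] is determined by the element, and [S] is
    weakly reductive ([acts_as_uniq]), so that an element [x] of a strict
    extension acts on [S] as exactly one member of [S], its shadow. Taking
    shadows is multiplicative ([acts_as_mul]), and by centrality so is passing
    from a member of [S] to the identity of its subgroup ([unit_pair_mul]).
    The composite therefore maps the extension homomorphically onto the
    semilattice of idempotents of [S]; its fibre over [e] contains the subgroup
    with identity [e] as an ideal, because multiplying a member of [S] by [x]
    amounts to multiplying it by the shadow of [x].

    For the converse, mutually inverse elements of the union of the groups must
    lie in one group, which gives uniqueness of inverses ([union_clifford]). If
    [x] lies in the component with group identity [e], then [e * x] is its
    shadow. Products of [x] with members of [S] lie in groups lower in the
    semilattice. The identity [g] of such a group satisfies [g * e = g], because
    [g * e] is an idempotent of the same group; so inserting [e] changes nothing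
    ([union_strict]).

    In both halves the required ideal extensions come from ideals: the Rees
    quotient by any ideal is a semigroup with zero
    ([ideal_extension_of_ideal]). *)

(** * Subsemigroups and Rees quotients as semigroups *)

(** A multiplicatively closed set is presented as an embedded abstract semigroup;
    this provides the index semilattice formed by the idempotents. *)
Lemma semigroup_of_closed_set (M : semigroupType) (A : set M) :
  (forall x y, A x -> A y -> A (x * y)) ->
  exists (Y : semigroupType) (i : Y -> M),
    [/\ injective i, {morph i : u v / u * v}, forall u, A (i u) &
        forall x, A x -> exists u, i u = x].
Proof.
move=> Amul.
have mul_in (u v : A) : val u * val v \in A.
  by rewrite inE; apply: Amul; apply: set_valP.
pose mul (u v : A) : A := exist _ (val u * val v) (mul_in u v).
have mul_assoc : associative mul.
  by move=> u v w; apply: val_inj; rewrite /= mulgA.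
pose Y : semigroupType := HB.pack {x : M | x \in A}
  (isSemigroup.Build {x : M | x \in A} mul_assoc).
exists Y, (@proj1_sig M (fun x => x \in A)); split.
- exact: val_inj.
- by [].
- exact: set_valP.
- by move=> x /mem_set Ax; exists (exist _ x Ax).
Qed.

Section ReesQuotient.
Variables (M : semigroupType) (A I : set M).
Hypotheses (Asub : subsemigroup A) (Iideal : ideal_of A I).

Lemma val_rees_in (x : set_type (A `\` I)) : A (val x).
Proof. by case: (set_valP x). Qed.

(** The projection [insub] from [A] onto the quotient is multiplicative on each
    side because [I] absorbs: once a factor has been sent to zero, so is the
    product. Associativity of the quotient is inherited from [M] through it. *)
Lemma rees_mul_insubl (a : M) (z : set_type (A `\` I)) :
  A a -> rees_mul (insub a : rees A I) (Some z) = insub (a * val z).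
Proof.
move=> Aa; case: insubP => [u _ <- //|na].
rewrite insubN //; move: na; apply: contra.
rewrite !inE => -[Aaz nI]; split=> // Ia; apply: nI.
by case: Iideal => _ _ /(_ _ _ Ia (val_rees_in z)) [].
Qed.

Lemma rees_mul_insubr (a : M) (z : set_type (A `\` I)) :
  A a -> rees_mul (Some z) (insub a : rees A I) = insub (val z * a).
Proof.
move=> Aa; case: insubP => [u _ <- //|na].
rewrite insubN //; move: na; apply: contra.
rewrite !inE => -[Aaz nI]; split=> // Ia; apply: nI.
by case: Iideal => _ _ /(_ _ _ Ia (val_rees_in z)) [].
Qed.

Lemma rees_mulA : associative (@rees_mul M A I).
Proof.
have mul0 u : rees_mul u (None : rees A I) = None by case: u.
have Amul := proj2 Asub.
move=> [x|] [y|] [z|] //; rewrite ?mul0 //.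
have [Ax Ay Az] := And3 (val_rees_in x) (val_rees_in y) (val_rees_in z).
rewrite -[rees_mul (Some y) _]/(insub _) -[rees_mul (Some x) (Some y)]/(insub _).
rewrite rees_mul_insubl ?rees_mul_insubr ?mulgA //; exact: Amul.
Qed.

Lemma ideal_extension_of_ideal : ideal_extension A I.
Proof.
pose T : semigroupType := HB.pack (option {x : M | x \in A `\` I})
  (isSemigroup.Build (option {x : M | x \in A `\` I}) rees_mulA).
exists T; split=> //.
- by exists (None : T); case.
- by exists id; split=> //; exists id.
Qed.

End ReesQuotient.

(** * Idempotents of a Clifford semigroup are central *)

Section Clifford.
Variables (M : semigroupType) (S : set M).
Hypothesis Scliff : clifford S.

Let Smul x y : S x -> S y -> S (x * y).
Proof. by case: Scliff => -[_ h] _ _; apply: h. Qed.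

Lemma inverse_uniq a x y : S a ->
  S x -> a * x * a = a -> x * a * x = x ->
  S y -> a * y * a = a -> y * a * y = y -> x = y.
Proof.
case: Scliff => _ _ /[apply] -[z [_ zu]] Sx ax xa Sy ay ya.
by rewrite -(zu x) // -(zu y).
Qed.

(** If [x] is the inverse of [e f], then so is [f x e], whence [x = f x e]. This
    makes [x] idempotent, hence its own inverse; as [e f] is also an inverse of
    [x], the two agree. *)
Lemma idem_mul e f : S e -> S f -> e * e = e -> f * f = f ->
  (e * f) * (e * f) = e * f.
Proof.
move=> Se Sf ee ff; have Sef := Smul Se Sf.
have [x [[Sx efx xef] _]] : exists! x, [/\ S x, e * f * x * (e * f) = e * f &
  x * (e * f) * x = x] by case: Scliff => _ _; apply.
have xE : x = f * x * e.
  apply: (@inverse_uniq (e * f)) => //; first by do 2 apply: Smul => //.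
  - by rewrite -[RHS]efx !mulgA -(mulgA e f f) ff -(mulgA _ e e) ee.
  - by rewrite -[in RHS]xef !mulgA -(mulgA _ e e) ee -(mulgA _ f f) ff.
have xx : x * x = x by rewrite xE -[in RHS]xef !mulgA.
suff <- : x = e * f by [].
by apply: (@inverse_uniq x) => //; rewrite ?xx.
Qed.

(** Once products of idempotents are idempotent, [f e] and [e f] are both
    inverses of [e f]. *)
Lemma idem_commute e f : S e -> S f -> e * e = e -> f * f = f -> e * f = f * e.
Proof.
move=> Se Sf ee ff; have efef := idem_mul Se Sf ee ff.
have fefe := idem_mul Sf Se ff ee.
apply: (@inverse_uniq (e * f)); rewrite ?efef //; try exact: Smul.
- by rewrite !mulgA -(mulgA e f f) ff -(mulgA _ e e) ee -[RHS]efef !mulgA.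
- by rewrite !mulgA -(mulgA f e e) ee -(mulgA _ f f) ff -[RHS]fefe !mulgA.
Qed.

(** Records membership in the maximal subgroup of [S] with identity [e]. The
    condition on [b] makes the relation symmetric in [a] and [b]. *)
Definition unit_pair (e a b : M) : Prop :=
  [/\ S a, S b, a * b = e, b * a = e & e * a = a /\ e * b = b].

Lemma unit_pair_idem e a b : unit_pair e a b -> S e /\ e * e = e.
Proof.
case=> Sa Sb ab ba [ea eb]; split; first by rewrite -ab; apply: Smul.
by rewrite -{2}ab mulgA ea ab.
Qed.

Lemma unit_pairC e a b : unit_pair e a b -> unit_pair e b a.
Proof. by case=> Sa Sb ab ba [ea eb]; split. Qed.

Lemma unit_pair_mulr e a b : unit_pair e a b -> a * e = a.
Proof. by case=> Sa Sb ab ba [ea eb]; rewrite -ba mulgA ab. Qed.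

Lemma unit_pair_inverse e a b : unit_pair e a b -> a * b * a = a.
Proof. by case=> Sa Sb -> ba []. Qed.

Lemma unit_pair_self e : S e -> e * e = e -> unit_pair e e e.
Proof. by move=> Se ee; split. Qed.

(** Complete regularity gives a commuting [x] with [a x a = a]; trimming it to
    [x a x] keeps it commuting and makes it a genuine inverse. *)
Lemma exists_unit_pair a : S a -> exists e b, unit_pair e a b.
Proof.
move=> Sa; have [x [Sx axa ax]] : exists x, [/\ S x, a * x * a = a &
  a * x = x * a] by case: Scliff => _ + _; apply.
exists (a * x), (x * a * x); split=> //.
- by apply: Smul => //; apply: Smul.
- by rewrite !mulgA axa.
- by rewrite -!mulgA (mulgA a) axa ax.
- split=> //; rewrite ax !mulgA -(mulgA x a x) -(mulgA x _ a) axa.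
  by rewrite mulgA.
Qed.

(** Both [e b] and a commuting inverse supplied by complete regularity are
    inverses of [a e], so they coincide; hence [a e b = e b a], and multiplying
    by [a] on the right yields [a e = e a]. *)
Lemma idem_central e a : S e -> S a -> e * e = e -> e * a = a * e.
Proof.
move=> Se Sa ee.
have [f [b ab]] := exists_unit_pair Sa.
have [Sf ff] := unit_pair_idem ab.
have ef := idem_commute Se Sf ee ff.
have [g [c aec]] := exists_unit_pair (Smul Sa Se).
have cE : c = e * b.
  have := unit_pair_inverse (unit_pairC aec).
  have := unit_pair_inverse aec.
  case: aec => _ Sc _ _ _ h1 h2.
  case: (ab) => _ Sb abf baf [fa fb].
  apply: (@inverse_uniq (a * e)) => //; try exact: Smul.
  - rewrite !mulgA -(mulgA a e e) ee -(mulgA _ b a) baf -(mulgA a e f) ef.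
    by rewrite mulgA (unit_pair_mulr ab) -mulgA ee.
  - rewrite !mulgA -(mulgA e b a) baf ef -(mulgA f e e) ee -(mulgA f e e) ee.
    by rewrite -ef -mulgA fb.
case: aec; rewrite cE => _ _ h1 h2 _.
case: (ab) => _ Sb abf baf [fa fb].
have h : a * e * b = e * f.
  have -> : a * e * b = g by rewrite -h1 !mulgA -(mulgA a e e) ee.
  by rewrite -h2 !mulgA -(mulgA e b a) baf -mulgA -ef mulgA ee.
have : a * e * b * a = e * f * a by rewrite h.
rewrite -(mulgA e f) fa -(mulgA (a * e)) baf -(mulgA a) ef mulgA.
by rewrite (unit_pair_mulr ab).
Qed.

(** The local identities multiply because they can be moved past [a] and [c]:
    [a c d b = a f b = a b f = e f]. *)
Lemma unit_pair_mul e a b f c d : unit_pair e a b -> unit_pair f c d ->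
  unit_pair (e * f) (a * c) (d * b).
Proof.
move=> ab cd.
have [[Se ee] [Sf ff]] := (unit_pair_idem ab, unit_pair_idem cd).
case: ab cd => Sa Sb abe bae [ea eb] [Sc Sd cdf dcf [fc fd]].
split; try exact: Smul.
- by rewrite !mulgA -(mulgA a c d) cdf -(mulgA a) (idem_central Sf Sb) // mulgA abe.
- by rewrite !mulgA -(mulgA d b a) bae -(mulgA d) (idem_central Se Sc) // mulgA dcf
    (idem_central Sf Se).
- split; rewrite !mulgA.
  + by rewrite -(mulgA e f a) (idem_central Sf Sa) // mulgA ea -mulgA fc.
  + by rewrite -(mulgA e f d) fd (idem_central Se Sd) // -mulgA eb.
Qed.

Lemma unit_pair_uniq e f a b c : unit_pair e a b -> unit_pair f a c -> e = f.
Proof.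
move=> ab ac.
have [[Se ee] [Sf ff]] := (unit_pair_idem ab, unit_pair_idem ac).
case: ab ac => Sa Sb abe bae [ea eb] [_ Sc acf caf [fa fc]].
have fe : f * e = e by rewrite -abe mulgA fa.
have ef : e * f = f by rewrite -acf mulgA ea.
by rewrite -fe idem_central.
Qed.

(** * Elements acting on a Clifford semigroup as its members *)

Definition acts_as (x a : M) : Prop :=
  forall s, S s -> x * s = a * s /\ s * x = s * a.

(** Let [e] and [f] be the local identities of [a] and [b]. Equality of the left
    actions gives [a = b e] and [b = a f]; then [a = a f e = a e f = a f = b],
    as [e] and [f] commute. *)
Lemma acts_as_uniq x a b : S a -> S b -> acts_as x a -> acts_as x b -> a = b.
Proof.
move=> Sa Sb xa xb.
have ab s : S s -> a * s = b * s.
  by move=> Ss; rewrite -(proj1 (xa s Ss)) (proj1 (xb s Ss)).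
have [e [a' aa']] := exists_unit_pair Sa.
have [f [b' bb']] := exists_unit_pair Sb.
have [[Se ee] [Sf ff]] := (unit_pair_idem aa', unit_pair_idem bb').
have be : b * e = a by rewrite -ab // (unit_pair_mulr aa').
have af : a * f = b by rewrite ab // (unit_pair_mulr bb').
by rewrite -[LHS]be -af -mulgA (idem_central Sf Se) // mulgA (unit_pair_mulr aa').
Qed.

Lemma acts_as_mul x a y c : S a -> S c -> acts_as x a -> acts_as y c ->
  acts_as (x * y) (a * c).
Proof.
move=> Sa Sc xa yc s Ss; split.
- by rewrite -!mulgA (proj1 (yc _ Ss)) (proj1 (xa _ (Smul Sc Ss))).
- rewrite !mulgA (proj2 (xa _ Ss)).
  by rewrite (proj2 (yc _ (Smul Ss Sa))).
Qed.

Definition unit_class (e : M) : set M := [set a | exists b, unit_pair e a b].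

(** The fibre over [e] of the map sending an element to the identity of the
    subgroup containing its shadow in [S]. *)
Definition action_class (e : M) : set M :=
  [set x | exists2 a, unit_class e a & acts_as x a].

Lemma unit_class_sub e a : unit_class e a -> S a.
Proof. by case=> b []. Qed.

Lemma unit_class_self e : S e -> e * e = e -> unit_class e e.
Proof. by move=> Se ee; exists e; apply: unit_pair_self. Qed.

Lemma unit_class_action e a : unit_class e a -> action_class e a.
Proof. by exists a. Qed.

Lemma unit_class_mul e f a c :
  unit_class e a -> unit_class f c -> unit_class (e * f) (a * c).
Proof. by move=> [b ab] [d cd]; exists (d * b); apply: unit_pair_mul. Qed.

Lemma action_class_mul e f x y :
  action_class e x -> action_class f y -> action_class (e * f) (x * y).
Proof.
move=> [a ea xa] [c fc yc]; exists (a * c); first exact: unit_class_mul.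
by apply: acts_as_mul => //; [apply: unit_class_sub ea | apply: unit_class_sub fc].
Qed.

Lemma action_class_uniq e f x : action_class e x -> action_class f x -> e = f.
Proof.
move=> [a ea xa] [c fc xc].
have ac := acts_as_uniq (unit_class_sub ea) (unit_class_sub fc) xa xc.
by case: ea fc => b ab [d]; rewrite -ac; apply: unit_pair_uniq ab.
Qed.

Lemma unit_class_group e : S e -> e * e = e -> is_group (unit_class e).
Proof.
move=> Se ee; split; first split.
- by exists e; apply: unit_class_self.
- by move=> x y ex ey; rewrite -ee; apply: unit_class_mul.
- exists e; split; first exact: unit_class_self.
  + by move=> x [b xb]; split; [case: xb => ? ? ? ? [] | apply: unit_pair_mulr xb].
  + by move=> x [b xb]; exists b; case: (xb); split=> //; exists x; apply: unit_pairC.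
Qed.

Lemma action_class_subsemigroup e :
  S e -> e * e = e -> subsemigroup (action_class e).
Proof.
move=> Se ee; split.
- by exists e; apply: unit_class_action; apply: unit_class_self.
- by move=> x y ex ey; rewrite -ee; apply: action_class_mul.
Qed.

(** A product with a factor in [S] can be computed after replacing the other
    factor by the element of [S] it acts as, so it stays in the group. *)
Lemma unit_class_ideal e :
  S e -> e * e = e -> ideal_of (action_class e) (unit_class e).
Proof.
move=> Se ee; split.
- by exists e; apply: unit_class_self.
- exact: unit_class_action.
- move=> s x es [a ea xa]; have [-> ->] := xa _ (unit_class_sub es).
  by rewrite -ee; split; apply: unit_class_mul.
Qed.

Lemma semilattice_of_group_extensions :
  (forall x, ~ S x -> exists2 a, S a & acts_as x a) ->
  exists (Y : semigroupType) (F : Y -> set M),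
    semilattice_of_semigroups F /\
    forall u, exists G : set M, is_group G /\ ideal_extension (F u) G.
Proof.
move=> Sstrict.
have [Y [i [i_inj iM iS iE]]] :
  exists (Y : semigroupType) (i : Y -> M),
    [/\ injective i, {morph i : u v / u * v},
        forall u, S (i u) /\ i u * i u = i u &
        forall e, S e /\ e * e = e -> exists u, i u = e].
  apply: (@semigroup_of_closed_set M [set e | S e /\ e * e = e]).
  move=> e f [Se ee] [Sf ff]; split; first exact: Smul.
  exact: idem_mul.
exists Y, (action_class \o i); split; last first.
  move=> u; have [Su uu] := iS u; exists (unit_class (i u)); split.
    exact: unit_class_group.
  apply: ideal_extension_of_ideal; first exact: action_class_subsemigroup.
  exact: unit_class_ideal.
split.
- split=> [u v|u]; apply: i_inj; rewrite !iM; last by case: (iS u).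
  by have [[Su uu] [Sv vv]] := (iS u, iS v); apply: idem_central.
- by move=> u; have [Su uu] := iS u; apply: action_class_subsemigroup.
- apply/seteqP; split=> // x _.
  have [a Sa xa] : exists2 a, S a & acts_as x a.
    by have [Sx|/Sstrict //] := pselect (S x); exists x.
  have [e [b ab]] := exists_unit_pair Sa.
  have [u ue] := iE _ (unit_pair_idem ab).
  by exists u => //=; exists a => //; exists b; rewrite ue.
- move=> u v _ _ [x [xu xv]]; apply: i_inj.
  exact: action_class_uniq xu xv.
- by move=> u v x y; rewrite /= iM; apply: action_class_mul.
Qed.

End Clifford.

(** * Semilattices of ideal extensions of groups *)

Lemma group_idem_identity (M : semigroupType) (G : set M) (e f : M) :
  is_group G -> G e -> (forall x, G x -> e * x = x /\ x * e = x) ->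
  G f -> f * f = f -> f = e.
Proof.
move=> [_ [e' [Ge' e'1 inv]]] Ge e1 Gf ff.
have ee' : e' = e by rewrite -[LHS](proj1 (e1 _ Ge')) (proj2 (e'1 _ Ge)).
have [g [Gg fg gf]] := inv _ Gf.
by rewrite -(proj1 (e'1 _ Gf)) -gf -mulgA ff gf.
Qed.

Section GroupExtensions.
Variables (M Y : semigroupType) (F G : Y -> set M).
Hypothesis Fsemi : semilattice_of_semigroups F.
Hypothesis Ggroup : forall a, is_group (G a).
Hypothesis Gext : forall a, ideal_extension (F a) (G a).
Hypothesis Sideal : ideal_of setT (\bigcup_a G a).

Local Notation S := (\bigcup_a G a).

Let Gideal a : ideal_of (F a) (G a).
Proof. by case: (Gext a) => T []. Qed.

Let GF a x : G a x -> F a x.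
Proof. by case: (Gideal a) => _ + _; apply. Qed.

Let FM a b x y : F a x -> F b y -> F (a * b) (x * y).
Proof. by case: Fsemi => _ _ _ _; apply. Qed.

Let F_uniq a b x : F a x -> F b x -> a = b.
Proof. by case: Fsemi => _ _ _ + _ Fax Fbx; apply=> //; exists x. Qed.

Let S_mull x y : S x -> S (x * y).
Proof. by move=> Sx; case: Sideal => _ _ /(_ _ y Sx I) []. Qed.

Let S_mulr x y : S y -> S (x * y).
Proof. by move=> Sx; case: Sideal => _ _ /(_ _ x Sx I) []. Qed.

Lemma union_inter_component a x : S x -> F a x -> G a x.
Proof. by move=> [b _ Gx] Fx; rewrite (F_uniq Fx (GF Gx)). Qed.

(** If [x] and [y] are mutually inverse, their components absorb each other in
    the semilattice, so both lie in one group, where inverses are unique. *)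
Lemma union_clifford : clifford S.
Proof.
have [[mulC mulI] _ _ _ _] := Fsemi.
split.
- split; first by case: Sideal.
  by move=> x y Sx _; apply: S_mull.
- move=> x [a _ Gx]; have [_ [e [Ge e1 /(_ _ Gx) [y [Gy xy yx]]]]] := Ggroup a.
  by exists y; rewrite xy yx; split=> //; [exists a | case: (e1 x Gx)].
- move=> x [a _ Gx]; have [_ [e [Ge e1 /(_ _ Gx) [y [Gy xy yx]]]]] := Ggroup a.
  exists y; split.
    by rewrite xy yx; split; [exists a | case: (e1 x Gx) | case: (e1 y Gy)].
  move=> z [[b _ Gz] xzx zxz].
  have ab : a = b.
    have /F_uniq h1 := FM (FM (GF Gx) (GF Gz)) (GF Gx).
    have /F_uniq h2 := FM (FM (GF Gz) (GF Gx)) (GF Gz).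
    rewrite xzx in h1; rewrite zxz in h2.
    rewrite -(h1 _ (GF Gx)) -[RHS](h2 _ (GF Gz)).
    by rewrite (mulC (a * b)) (mulC (b * a)) !mulgA mulI mulI mulC.
  rewrite -ab in Gz.
  have [[ez ze] [ey _]] := (e1 _ Gz, e1 _ Gy).
  (* In the group [G a], [z] is recovered from [x * z * x] by cancelling [x]. *)
  have zE : y * (x * z * x) * y = z by rewrite !mulgA yx ez -mulgA xy ze.
  by rewrite -zE xzx yx ey.
Qed.

(** For [x] in [F a], the member of [S] with the same action is [e x], where
    [e] is the identity of [G a]; it equals [x e], as both lie in [G a]. Indeed, let [s] be in [G b] and let [g]
    be the identity of [G (a b)]: then [x s] and [s x] lie in [G (a b)], and [g e],
    being an idempotent of that group, equals [g]; thus [e] acts trivially on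
    the products. *)
Lemma union_strict x : exists2 a, S a & acts_as S x a.
Proof.
have [[mulC mulI] _ Fcov _ _] := Fsemi.
have [a _ Fx] : (\bigcup_a F a) x by rewrite Fcov.
have [_ [e [Ge e1 _]]] := Ggroup a.
have [Gex Gxe] : G a (e * x) /\ G a (x * e).
  by case: (Gideal a) => _ _; apply.
have ex_xe : e * x = x * e.
  by rewrite -(proj2 (e1 _ Gex)) -(proj1 (e1 _ Gxe)) mulgA.
exists (e * x); first by exists a.
move=> s Ss; case: (Ss) => b _ Gs.
have [_ [g [Gg g1 _]]] := Ggroup (a * b).
have Gge : G (a * b) (g * e).
  apply: union_inter_component; first by apply: S_mull; exists (a * b).
  have := FM (GF Gg) (GF Ge).
  by rewrite (mulC (a * b)) mulgA mulI.
have ge : g * e = g.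
  apply: (group_idem_identity (Ggroup (a * b))) => //.
  by rewrite mulgA (proj2 (g1 _ Gge)) -mulgA (proj1 (e1 _ Ge)).
have Gxs : G (a * b) (x * s).
  by apply: union_inter_component; [apply: S_mulr | apply/FM/GF].
have Gexs : G (a * b) (e * x * s).
  apply: union_inter_component; first exact: S_mulr.
  by apply: FM (GF Gs); apply: GF.
have Gsx : G (a * b) (s * x).
  apply: union_inter_component; first exact: S_mull.
  by rewrite mulC; apply: FM => //; apply: GF.
split.
- by rewrite -[RHS](proj1 (g1 _ Gexs)) !mulgA ge -mulgA (proj1 (g1 _ Gxs)).
- rewrite ex_xe mulgA -[in RHS](proj2 (g1 _ Gsx)) -[RHS]mulgA ge.
  by rewrite (proj2 (g1 _ Gsx)).
Qed.

End GroupExtensions.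

Theorem theorem4p3 (Sigma : semigroupType) :
  (forall (S : set Sigma) (T : semigroupType),
     clifford S -> strict_extension_by setT S T ->
     exists (Y : semigroupType) (F : Y -> set Sigma),
       semilattice_of_semigroups F /\
       forall a, exists G : set Sigma, is_group G /\ ideal_extension (F a) G)
  /\
  (forall (Y : semigroupType) (F G : Y -> set Sigma),
     semilattice_of_semigroups F ->
     (forall a, is_group (G a) /\ ideal_extension (F a) (G a)) ->
     ideal_of setT (\bigcup_a G a) ->
     clifford (\bigcup_a G a) /\ strict_extension setT (\bigcup_a G a)).
Proof.
split=> [S T Scliff [_ Sstrict]|Y F G Fsemi Gprop Sideal].
  apply: (semilattice_of_group_extensions Scliff) => x nSx.
  exact: Sstrict.
have Ggroup a : is_group (G a) by case: (Gprop a).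
have Gext a : ideal_extension (F a) (G a) by case: (Gprop a).
split; first exact: (union_clifford Fsemi).
have Tsub : subsemigroup [set: Sigma].
  by split=> //; case: Sideal => -[x _] _ _; exists x.
have [T ST] := ideal_extension_of_ideal Tsub Sideal.
by exists T; split=> // x _; apply: (union_strict Fsemi).
Qed.
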